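(* Let $\alpha: I\to\mathbb{R}^3$ be a Frenet curve with arc length parameter $s$, curvature $\kappa$ and torsion $\tau$. If $\gamma$ is the osculating-direction curve of $\alpha$, then the curvature $\bar\kappa$ and the torsion $\bar\tau$ of the curve $\gamma$ are given by $$\bar\kappa=\tau\cos\left(\int\kappa\,ds\right),\qquad \bar\tau=\tau\sin\left(\int\kappa\,ds\right).$$
   Context: $I\subset\mathbb{R}$ is an open interval. A unit speed curve $\alpha: I\to\mathbb{R}^3$ is a Frenet curve if its curvature $\kappa(s)=\|\alpha''(s)\|$ satisfies $\kappa(s)\neq0$; its Frenet frame is $T=\alpha'$, $N=\alpha''/\kappa$, $B=T\times N$, with $T'=\kappa N$, $N'=-\kappa T+\tau B$, $B'=-\tau N$, where $\tau$ is the torsion. Osculating-direction curve: let $X$ be a unit vector field lying on the osculating plane of $\alpha$ and given by $X(s)=u(s)T(s)+v(s)N(s)$ with $u,v$ differentiable, $u(s)\neq0$, $v(s)\neq0$ and $X'(s)\notin \mathrm{Sp}\{T,N\}$, where $\mathrm{Sp}$ denotes linear span. An integral curve $\gamma: I\to\mathbb{R}^3$ of $X$ (that is, $\gamma'(s)=X(s)$) is called an osculating-direction curve of $\alpha$, and $\alpha$ is called the osculating-donor curve of $\gamma$. Such a $\gamma$ has unit speed, with the same parameter $s$; its curvature and torsion are denoted $\bar\kappa,\bar\tau$. The symbol $\int\kappa\,ds$ denotes an indefinite integral of $\kappa$, the same one in both formulas, namely the one occurring in the expressions $u=\sin\left(\int\kappa\,ds\right)$, $v=\cos\left(\int\kappa\,ds\right)$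 of the coefficients of $X$.
   Formalization: The curvature, being the norm of γ'', equals |τ cos(∫κ ds)|; the formula without absolute value fails when τ cos(∫κ ds)<0 and is proved as the curvature signed by the normal B. That u=sin(∫κ ds), v=cos(∫κ ds) is assumed. *)

(* Defs.v *)
From mathcomp Require Import all_boot all_order all_algebra.
From mathcomp Require Import all_classical all_reals all_analysis.

Set Implicit Arguments.
Unset Strict Implicit.
Unset Printing Implicit Defensive.

Import Order.TTheory GRing.Theory Num.Theory.
Import numFieldNormedType.Exports.

#[global] Open Scope classical_set_scope.
#[global] Open Scope ring_scope.

(* The library norm `| _ | on 'rV[R]_3 is the sup norm, hence enorm. *)
Definition dotp (R : realType) (a b : 'rV[R]_3) : R :=
  \sum_(i < 3) a 0 i * b 0 i.

Definition enorm (R : realType) (a : 'rV[R]_3) : R := Num.sqrt (dotp a a).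

(* Indices are added modulo 3. *)
Definition crossp (R : realType) (a b : 'rV[R]_3) : 'rV[R]_3 :=
  \row_(k < 3) (a 0 (k + 1) * b 0 (k + 2) - a 0 (k + 2) * b 0 (k + 1)).

Definition tangent (R : realType) (c : R -> 'rV[R]_3) : R -> 'rV[R]_3 := c^`()%classic.

Definition curvature (R : realType) (c : R -> 'rV[R]_3) (s : R) : R :=
  enorm (c^`()^`()%classic s).

Definition normal (R : realType) (c : R -> 'rV[R]_3) (s : R) : 'rV[R]_3 :=
  (curvature c s)^-1 *: c^`()^`()%classic s.

Definition binormal (R : realType) (c : R -> 'rV[R]_3) (s : R) : 'rV[R]_3 :=
  crossp (tangent c s) (normal c s).

(* The coefficient of B in N' = - kappa T + tau B, read off by taking the dot
   product with the unit vector B. *)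
Definition torsion (R : realType) (c : R -> 'rV[R]_3) (s : R) : R :=
  dotp ((normal c)^`()%classic s) (binormal c s).

(* The regularity required is the existence of c'' and N', which is what the
   Frenet frame and its derivative formulas need; it holds for every C^3 unit
   speed curve with nonvanishing curvature. *)
Definition frenet_curve (R : realType) (I : set R) (c : R -> 'rV[R]_3) : Prop :=
  forall s, I s ->
  [/\ derivable c s 1, derivable c^`()%classic s 1, enorm (c^`()%classic s) = 1,
      curvature c s != 0 & derivable (normal c) s 1].

(* The Frenet equations of a unit speed curve c for the positively oriented
   orthonormal frame (c', n, c' x n), where n is a given unit normal field.
   Since n need not point in the direction of c'', k may be negative: it is the
   curvature signed by n. *)
Definition frenet_equations (R : realType) (I : set R) (c n : R -> 'rV[R]_3)
    (k t : R -> R) : Prop :=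
  let b := fun s => crossp (tangent c s) (n s) in
  forall s, I s ->
  [/\ enorm (tangent c s) = 1, enorm (n s) = 1 & dotp (tangent c s) (n s) = 0]
  /\ [/\ is_derive s 1 (tangent c) (k s *: n s),
         is_derive s 1 n (- k s *: tangent c s + t s *: b s) &
         is_derive s 1 b (- t s *: n s)].

Definition osculating_field (R : realType) (c : R -> 'rV[R]_3) (u v : R -> R)
    (s : R) : 'rV[R]_3 :=
  u s *: tangent c s + v s *: normal c s.

(* g is an integral curve of the unit field X = u T + v N along c. *)
Definition osculating_direction_curve (R : realType) (I : set R)
    (c : R -> 'rV[R]_3) (u v : R -> R) (g : R -> 'rV[R]_3) : Prop :=
  let X := osculating_field c u v in
  forall s, I s ->
  [/\ derivable u s 1, derivable v s 1, u s != 0 & v s != 0]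
  /\ [/\ enorm (X s) = 1,
         X^`()%classic s \notin <<[:: tangent c s; normal c s]>>%VS &
         is_derive s 1 g (X s)].

(* Main.v *)
(* By the Frenet formulas of alpha, the field X = sin K T + cos K N with
   K' = kappa satisfies X' = tau cos K B: the terms in kappa cancel. Hence, with
   B as signed unit normal, gamma has the Frenet frame
   (X, B, cos K T - sin K N), signed curvature tau cos K and torsion tau sin K.
   The principal normal of gamma is B up to the sign of tau cos K; that sign is
   locally constant because X' is not in Sp {T, N}, so tau cos K never vanishes,
   and because B' = - tau N, so that Darboux's theorem keeps tau, which need not
   be continuous, from changing sign without vanishing. *)

Require Import Defs.
From mathcomp Require Import all_boot all_order all_algebra.
From mathcomp Require Import all_classical all_reals all_analysis.
From mathcomp Require Import ring.
Import Order.TTheory GRing.Theory Num.Theory.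
Import numFieldNormedType.Exports.

Set Implicit Arguments.
Unset Strict Implicit.

(** * Dot and cross product algebra in coordinates *)

Section euclidean_space.
Context {R : realType}.
Implicit Types (a b c w : 'rV[R]_3) (k : R).

Lemma forall_ord3 (P : 'I_3 -> Prop) : P 0 -> P 1 -> P 2 -> forall i, P i.
Proof.
move=> P0 P1 P2 [[|[|[|//]]] i3].
- by have -> : Ordinal i3 = 0 by exact: val_inj.
- by have -> : Ordinal i3 = 1 by exact: val_inj.
- by have -> : Ordinal i3 = 2 by exact: val_inj.
Qed.

Lemma dotpE a b : dotp a b = a 0 0 * b 0 0 + a 0 1 * b 0 1 + a 0 2 * b 0 2.
Proof.
rewrite /dotp !big_ord_recr big_ord0 /= add0r.
by congr (a 0 _ * b 0 _ + a 0 _ * b 0 _ + a 0 _ * b 0 _); exact: val_inj.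
Qed.

Lemma crosspE a b :
  [/\ crossp a b 0 0 = a 0 1 * b 0 2 - a 0 2 * b 0 1,
      crossp a b 0 1 = a 0 2 * b 0 0 - a 0 0 * b 0 2 &
      crossp a b 0 2 = a 0 0 * b 0 1 - a 0 1 * b 0 0].
Proof.
by split; rewrite mxE; congr (a 0 _ * b 0 _ - a 0 _ * b 0 _); exact: val_inj.
Qed.

Lemma rV3P a b : a 0 0 = b 0 0 -> a 0 1 = b 0 1 -> a 0 2 = b 0 2 -> a = b.
Proof. by move=> *; apply/rowP; exact: forall_ord3. Qed.

(** The three conjuncts of [crosspE], split so that each can serve as a rewrite rule. *)
Definition crosspE0 a b := let: And3 e _ _ := crosspE a b in e.
Definition crosspE1 a b := let: And3 _ e _ := crosspE a b in e.
Definition crosspE2 a b := let: And3 _ _ e := crosspE a b in e.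

Lemma dotpC a b : dotp a b = dotp b a.
Proof. by rewrite !dotpE; ring. Qed.

Lemma dotpDl a b c : dotp (a + b) c = dotp a c + dotp b c.
Proof. by rewrite !dotpE !mxE; ring. Qed.

Lemma dotpZl k a b : dotp (k *: a) b = k * dotp a b.
Proof. by rewrite !dotpE !mxE; ring. Qed.

Lemma dotpZr k a b : dotp a (k *: b) = k * dotp a b.
Proof. by rewrite dotpC dotpZl dotpC. Qed.

Lemma dotpr0 a : dotp a 0 = 0.
Proof. by rewrite -(scale0r a) dotpZr mul0r. Qed.

Lemma dotp_ge0 a : 0 <= dotp a a.
Proof. by rewrite dotpE !addr_ge0// -expr2 sqr_ge0. Qed.

Lemma enorm1P a : enorm a = 1 <-> dotp a a = 1.
Proof.
split=> [a1|a1]; last by rewrite /enorm a1 sqrtr1.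
by rewrite -(sqr_sqrtr (dotp_ge0 a)) -[Num.sqrt _]/(enorm a) a1 expr1n.
Qed.

Lemma enormZ k a : enorm (k *: a) = `|k| * enorm a.
Proof.
by rewrite /enorm dotpZl dotpZr mulrA -expr2 sqrtrM ?sqr_ge0// sqrtr_sqr.
Qed.

Lemma crosspDl a b c : crossp (a + b) c = crossp a c + crossp b c.
Proof.
by apply: rV3P; rewrite !(crosspE0, crosspE1, crosspE2, mxE); ring.
Qed.

Lemma crosspZl k a b : crossp (k *: a) b = k *: crossp a b.
Proof.
by apply: rV3P; rewrite !(crosspE0, crosspE1, crosspE2, mxE); ring.
Qed.

Lemma crosspDr a b c : crossp a (b + c) = crossp a b + crossp a c.
Proof.
by apply: rV3P; rewrite !(crosspE0, crosspE1, crosspE2, mxE); ring.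
Qed.

Lemma crosspZr k a b : crossp a (k *: b) = k *: crossp a b.
Proof.
by apply: rV3P; rewrite !(crosspE0, crosspE1, crosspE2, mxE); ring.
Qed.

Lemma crosspp a : crossp a a = 0.
Proof.
by apply: rV3P; rewrite !(crosspE0, crosspE1, crosspE2, mxE); ring.
Qed.

Lemma crosspC a b : crossp a b = - crossp b a.
Proof.
by apply: rV3P; rewrite !(crosspE0, crosspE1, crosspE2, mxE); ring.
Qed.

Lemma dotp_crossp a b : dotp a (crossp a b) = 0.
Proof. by rewrite dotpE !(crosspE0, crosspE1, crosspE2); ring. Qed.

Lemma dotp_crosspr a b : dotp b (crossp a b) = 0.
Proof. by rewrite dotpE !(crosspE0, crosspE1, crosspE2); ring. Qed.

Lemma crossp_crossp a b c :
  crossp a (crossp b c) = dotp a c *: b - dotp a b *: c.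
Proof.
by apply: rV3P;
  rewrite !(crosspE0, crosspE1, crosspE2) !mxE !dotpE; ring.
Qed.

Lemma dotp_crossp_crossp a b :
  dotp (crossp a b) (crossp a b) = dotp a a * dotp b b - dotp a b ^+ 2.
Proof. by rewrite !dotpE !(crosspE0, crosspE1, crosspE2); ring. Qed.

(** Cramer's rule with the determinant cleared, hence a polynomial identity in the coordinates: up
    to that factor, the three cross products are the basis dual to [a], [b], [c]. *)
Lemma cramer3 a b c w : dotp a (crossp b c) *: w =
  dotp w a *: crossp b c + dotp w b *: crossp c a + dotp w c *: crossp a b.
Proof.
by apply: rV3P;
  rewrite !(dotpE, crosspE0, crosspE1, crosspE2, mxE); ring.
Qed.

(** * Positively oriented orthonormal frames *)

Section orthonormal_frame.
Context {t n : 'rV[R]_3}.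
Hypotheses (t1 : dotp t t = 1) (n1 : dotp n n = 1) (tn : dotp t n = 0).
Let b := crossp t n.

Lemma frame_tb : crossp t b = - n.
Proof. by rewrite crossp_crossp tn t1 scale0r scale1r sub0r. Qed.

Lemma frame_nb : crossp n b = t.
Proof. by rewrite crossp_crossp n1 dotpC tn scale0r scale1r subr0. Qed.

Lemma frame_bb : dotp b b = 1.
Proof. by rewrite dotp_crossp_crossp t1 n1 tn; ring. Qed.

(** Cramer's rule for [t], [n], [b]: the determinant is [dotp t t = 1], and the frame is its own
    dual basis because [n x b = t], [b x t = n] and [t x n = b]. *)
Lemma frame_decomposition w :
  w = dotp w t *: t + dotp w n *: n + dotp w b *: b.
Proof.
have := cramer3 t n b w.
by rewrite frame_nb t1 scale1r (crosspC b t) frame_tb opprK.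
Qed.

End orthonormal_frame.

End euclidean_space.

(** * Product rules for vector functions, and the sign of a nonvanishing derivative *)

Section derivatives.
Context {R : realType}.

(** Passing to coordinates reduces the product rules below to the scalar one. *)
Lemma is_derive_rVP n (M : R -> 'rV[R]_n) (d : 'rV[R]_n) (x : R) :
  is_derive x 1 M d <-> forall j, is_derive x 1 (fun y => M y 0 j) (d 0 j).
Proof.
split=> [[Mx <-] j|Mx].
  apply: DeriveDef; first by move/derivable_mxP : Mx => /(_ 0 j).
  by rewrite derive_mx// mxE.
have dM : derivable M x 1.
  by apply/derivable_mxP => i j; rewrite ord1; case: (Mx j).
apply: DeriveDef => //; rewrite derive_mx//; apply/rowP => j.
by rewrite mxE; case: (Mx j).
Qed.

Lemma is_derive_scale n (f : R -> R) (M : R -> 'rV[R]_n) df dM (x : R) :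
  is_derive x 1 f df -> is_derive x 1 M dM ->
  is_derive x 1 (fun y => f y *: M y) (df *: M x + f x *: dM).
Proof.
move=> fx /is_derive_rVP Mx; apply/is_derive_rVP => j.
have -> : (fun y => (f y *: M y) 0 j) = f * (fun y => M y 0 j).
  by apply/funext => y; rewrite mxE.
apply: is_derive_eq (is_deriveM fx (Mx j)) _.
by rewrite !mxE addrC; congr (_ + _); rewrite mulrC.
Qed.

Lemma is_derive_dotp (a b : R -> 'rV[R]_3) da db (x : R) :
  is_derive x 1 a da -> is_derive x 1 b db ->
  is_derive x 1 (fun y => dotp (a y) (b y)) (dotp da (b x) + dotp (a x) db).
Proof.
move=> /is_derive_rVP ax /is_derive_rVP bx.
have -> : (fun y => dotp (a y) (b y)) =
    (fun y => a y 0 0) * (fun y => b y 0 0) +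
    (fun y => a y 0 1) * (fun y => b y 0 1) +
    (fun y => a y 0 2) * (fun y => b y 0 2).
  by apply/funext => y; rewrite dotpE.
have h i := is_deriveM (ax i) (bx i).
apply: is_derive_eq (is_deriveD (is_deriveD (h 0) (h 1)) (h 2)) _.
by rewrite !dotpE /GRing.scale/=; ring.
Qed.

Lemma is_derive_crossp (a b : R -> 'rV[R]_3) da db (x : R) :
  is_derive x 1 a da -> is_derive x 1 b db ->
  is_derive x 1 (fun y => crossp (a y) (b y))
    (crossp da (b x) + crossp (a x) db).
Proof.
move=> /is_derive_rVP ax /is_derive_rVP bx; apply/is_derive_rVP => k.
have -> : (fun y => crossp (a y) (b y) 0 k) =
    (fun y => a y 0 (k + 1)) * (fun y => b y 0 (k + 2)) -
    (fun y => a y 0 (k + 2)) * (fun y => b y 0 (k + 1)).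
  by apply/funext => y; rewrite mxE.
have h i j := is_deriveM (ax i) (bx j).
apply: is_derive_eq (is_deriveB (h _ _) (h _ _)) _.
by rewrite !mxE /GRing.scale/=; ring.
Qed.

Lemma is_derive_near_cst (f : R -> R) (c df x : R) :
  (\forall y \near x, f y = c) -> is_derive x 1 f df -> df = 0.
Proof.
move=> fc fx; have := near_eq_is_derive fc fx.
by move=> [_ <-]; exact: derive_cst.
Qed.

(* Rolle's theorem makes f injective, hence strictly monotone. *)
Lemma derive_sg_cst (f df : R -> R) (a b : R) :
  (forall x, x \in `]a, b[ -> is_derive x 1 f (df x) /\ df x != 0) ->
  {in `]a, b[ &, forall x y, Num.sg (df x) = Num.sg (df y)}.
Proof.
move=> fdf.
have fd : {in `]a, b[, forall x, derivable f x 1}.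
  by move=> x /fdf[[]].
have f'E : {in `]a, b[, forall x : R, derive1 f x = df x}.
  by move=> x /fdf[[_ <-] _]; rewrite derive1E.
have fc := derivable_within_continuous fd.
have finj : {in `]a, b[ &, injective f}.
  suff lt_neq x y : x \in `]a, b[ -> y \in `]a, b[ -> x < y -> f x != f y.
    move=> x y xab yab fxy; case: (ltgtP x y) => // xy.
      by have := lt_neq _ _ xab yab xy; rewrite fxy eqxx.
    by have := lt_neq _ _ yab xab xy; rewrite fxy eqxx.
  move=> xab yab xy; apply/eqP => fxy.
  have sub z : z \in `[x, y] -> z \in `]a, b[.
    move: xab yab; rewrite !in_itv/= => /andP[ax _] /andP[_ yb] /andP[xz zy].
    by rewrite (lt_le_trans ax xz) (le_lt_trans zy yb).
  have xyd : {in `[x, y], forall z, derivable f z 1} by move=> z /sub/fd.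
  have [|z zxy [_ f'z]] := Rolle xy _ (derivable_within_continuous xyd) fxy.
    by move=> z zxy; apply: xyd; exact: subset_itv_oo_cc.
  have zab : z \in `]a, b[ by apply: sub; exact: subset_itv_oo_cc.
  by have [_ /eqP] := fdf z zab; rewrite -f'E// derive1E.
have [fincr|fdecr] := itv_continuous_inj_mono fc finj.
- have pos x : x \in `]a, b[ -> Num.sg (df x) = 1.
    move=> xab; have [_ dfx0] := fdf x xab.
    (* Monotonicity gives only a weak inequality for the derivative; nonvanishing makes it
       strict. *)
    rewrite gtr0_sg// lt_neqAle eq_sym dfx0 -f'E//=.
    apply: (@incr_derive1_ge0_itv _ _ false true a b) xab.
      by move=> z /[!inE]; exact: fd.
    exact: fincr.
  by move=> x y xab yab; rewrite !pos.
- have neg x : x \in `]a, b[ -> Num.sg (df x) = - 1.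
    move=> xab; have [_ dfx0] := fdf x xab.
    rewrite ltr0_sg// lt_neqAle dfx0 -f'E//=.
    apply: (@decr_derive1_le0_itv _ _ false true a b) xab.
      by move=> z /[!inE]; exact: fd.
    by move=> y z yab zab; exact: fdecr.
  by move=> x y xab yab; rewrite !neg.
Qed.

End derivatives.

(** * From Frenet curves to Frenet equations and back *)

Section frenet.
Context {R : realType} {I : set R}.
Hypothesis I_open : open I.
Implicit Types (c n : R -> 'rV[R]_3) (k t : R -> R) (s : R).

Lemma near_in_open s : I s -> \forall y \near s, I y.
Proof. by move=> Is; exact: open_nbhs_nbhs. Qed.

(** As [I] is open, the dot product is constant near [s], so the product rule yields zero. Applied
    to the orthonormality relations, this determines the coefficients of the frame's derivatives. *)
Lemma derive_dotp_cst (a b : R -> 'rV[R]_3) da db (r s : R) :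
  (forall y, I y -> dotp (a y) (b y) = r) -> I s ->
  is_derive s 1 a da -> is_derive s 1 b db ->
  dotp da (b s) + dotp (a s) db = 0.
Proof.
move=> abr Is as' bs.
apply: is_derive_near_cst (is_derive_dotp as' bs).
by near=> y; apply: abr; near: y; exact: near_in_open.
Unshelve. all: by end_near. Qed.

(** Expand [N'] in the frame: differentiating [N . N = 1] kills the coefficient of [N],
    differentiating [T . N = 0] gives [- kappa] along [T], and the coefficient of [B] is the torsion
    by definition. *)
Lemma frenet_curve_equations c : frenet_curve I c ->
  frenet_equations I c (normal c) (curvature c) (torsion c).
Proof.
move=> fc.
have TT y : I y -> dotp (tangent c y) (tangent c y) = 1.
  by move=> /fc[_ _ /enorm1P].
have NN y : I y -> dotp (normal c y) (normal c y) = 1.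
  move=> /fc[_ _ _ k0 _]; apply/enorm1P.
  by rewrite /normal enormZ normfV ger0_norm ?sqrtr_ge0// mulVf.
have T' y : I y -> is_derive y 1 (tangent c) (curvature c y *: normal c y).
  move=> /fc[_ c'd _ k0 _]; apply: DeriveDef; first exact: c'd.
  by rewrite /normal scalerA mulfV// scale1r derive1E.
have TN y : I y -> dotp (tangent c y) (normal c y) = 0.
  move=> Iy; have [_ _ _ k0 _] := fc y Iy.
  (* Differentiating [T . T = 1] gives [2 kappa (N . T) = 0], where [kappa] is nonzero. *)
  have := derive_dotp_cst TT Iy (T' y Iy) (T' y Iy).
  rewrite dotpZl dotpZr (dotpC (normal c y)) -mulr2n => /eqP.
  by rewrite mulrn_eq0/= mulf_eq0 (negbTE k0) => /eqP.
move=> s Is; have [_ _ _ _ Nd] := fc s Is.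
have T1 := TT s Is; have N1 := NN s Is; have TN0 := TN s Is.
have N'0 : is_derive s 1 (normal c) ((normal c)^`()%classic s).
  by apply: DeriveDef; [exact: Nd | rewrite derive1E].
have N'T := derive_dotp_cst TN Is (T' s Is) N'0.
have N'N := derive_dotp_cst NN Is N'0 N'0.
have N' : is_derive s 1 (normal c)
    (- curvature c s *: tangent c s + torsion c s *: binormal c s).
  apply: is_derive_eq N'0 _.
  rewrite [LHS](frame_decomposition T1 N1 TN0).
  rewrite -[dotp _ (crossp _ _)]/(torsion c s).
  have -> : dotp ((normal c)^`()%classic s) (normal c s) = 0.
    by move: N'N; rewrite dotpC -mulr2n => /eqP; rewrite mulrn_eq0/= => /eqP.
  have -> : dotp ((normal c)^`()%classic s) (tangent c s) = - curvature c s.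
    apply/eqP; rewrite -addr_eq0 dotpC addrC.
    by rewrite dotpZl N1 mulr1 in N'T; rewrite N'T.
  by rewrite scale0r addr0.
split; first by split=> //; exact/enorm1P.
split; [exact: T' | exact: N' |].
(* In [B' = T' x N + T x N'] the terms [N x N] and [T x T] vanish, leaving
   [tau (T x B) = - tau N]. *)
apply: is_derive_eq (is_derive_crossp (T' s Is) N') _.
rewrite crosspZl crosspp scaler0 add0r crosspDr !crosspZr crosspp scaler0 add0r.
by rewrite (frame_tb T1 TN0) scalerN scaleNr.
Qed.

(* Near s, the derivative of the scalar function b . n(s) is - t times the
   positive factor n . n(s). *)
Lemma frenet_equations_sg_torsion c n k t s :
  frenet_equations I c n k t -> (forall y, I y -> t y != 0) -> I s ->
  \forall y \near s, Num.sg (t y) = Num.sg (t s).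
Proof.
move=> fe t0 Is; pose b y := crossp (tangent c y) (n y).
have [[_ /enorm1P n1 _] [_ ns' _]] := fe s Is.
pose h y := dotp (n y) (n s).
have h_cont : {for s, continuous h}.
  apply/differentiable_continuous/derivable1_diffP.
  by have [] := is_derive_dotp ns' (is_derive_cst (n s) s 1).
(* [h] is continuous at [s] and takes the value 1 there. *)
have h_pos : \forall y \near s, 0 < h y.
  have hs : 0 < h s by rewrite /h n1.
  exact: cvgr_gt h_cont _ hs.
have : \forall y \near s, I y /\ 0 < h y.
  by apply: filterI => //; exact: near_in_open.
move=> [e /= e0 He].
have inball y : y \in `]s - e, s + e[ -> I y /\ 0 < h y.
  by move=> /[!in_itv]/= yse; apply: He; rewrite /= ltr_distlC.
have sgt y : y \in `]s - e, s + e[ -> Num.sg (- t y * h y) = - Num.sg (t y).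
  by move=> /inball[_ hy]; rewrite sgrM sgrN (gtr0_sg hy) mulr1.
have se : s \in `]s - e, s + e[ by rewrite in_itv/= ltrBlDr !ltrDl e0.
exists e => //= y /=; rewrite ltr_distlC => yse.
have {}yse : y \in `]s - e, s + e[ by rewrite in_itv.
apply: oppr_inj; rewrite -!sgt//.
apply: (@derive_sg_cst R (fun y => dotp (b y) (n s)) (fun y => - t y * h y)
  (s - e) (s + e)) => //.
move=> z /inball[Iz hz]; split; last by rewrite mulf_neq0 ?oppr_eq0 ?t0 ?gt_eqF.
have [_ [_ _ bz]] := fe z Iz.
apply: is_derive_eq (is_derive_dotp bz (is_derive_cst (n s) z 1)) _.
by rewrite dotpZl dotpr0 addr0.
Qed.

(** The principal normal is [n] times the sign of [k]. This sign is locally constant, so it passes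
    through the derivative as a constant factor. *)
Lemma frenet_equations_curve c n k t :
  frenet_equations I c n k t ->
  (forall s, I s -> derivable c s 1) -> (forall s, I s -> k s != 0) ->
  (forall s, I s -> \forall y \near s, Num.sg (k y) = Num.sg (k s)) ->
  [/\ frenet_curve I c, (forall s, I s -> curvature c s = `|k s|) &
      (forall s, I s -> torsion c s = t s)].
Proof.
move=> fe cd k0 ksg.
have c'' s : I s -> c^`()^`()%classic s = k s *: n s.
  by move=> /fe[_ [[_ <-] _ _]]; rewrite derive1E.
have kE s : I s -> curvature c s = `|k s|.
  move=> Is; have [[_ n1 _] _] := fe s Is.
  by rewrite /curvature c''// enormZ n1 mulr1.
have nE s : I s -> normal c s = Num.sg (k s) *: n s.
  move=> Is; rewrite /normal kE// c''// scalerA; congr (_ *: _).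
  by rewrite {2}(numEsg (k s)) mulrCA mulVf ?mulr1// normr_eq0 k0.
have nd s : I s -> is_derive s 1 (normal c)
    (Num.sg (k s) *:
      (- k s *: tangent c s + t s *: crossp (tangent c s) (n s))).
  move=> Is; have [_ [_ n' _]] := fe s Is.
  apply: near_eq_is_derive (is_deriveZ (Num.sg (k s)) n').
  near=> y; rewrite nE; last by near: y; exact: near_in_open.
  by congr (_ *: _); apply/esym; near: y; exact: ksg.
split=> //.
- move=> s Is; have [[T1 _ _] [[T' _] _ _]] := fe s Is.
  split; [exact: cd | exact: T' | exact: T1 | | by case: (nd s Is)].
  by rewrite kE// normr_eq0 k0.
- move=> s Is; have [[/enorm1P T1 /enorm1P n1 Tn] _] := fe s Is.
  (* The torsion picks up the sign of [k] twice, once from the derivative of the normal and once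
     from the binormal. *)
  have sg2 : Num.sg (k s) * Num.sg (k s) = 1.
    by rewrite -expr2 sqr_sg k0.
  rewrite /torsion; have [_ nd'] := nd s Is; rewrite derive1E nd'.
  rewrite /binormal nE// crosspZr dotpZl dotpZr mulrA sg2 mul1r.
  rewrite dotpDl !dotpZl dotp_crossp (frame_bb T1 n1 Tn).
  by rewrite mulr0 add0r mulr1.
Unshelve. all: by end_near. Qed.

End frenet.

(** * Curvature and torsion of osculating-direction curves *)

Theorem theorem3p3 (R : realType) (I : set R) (alpha gamma : R -> 'rV[R]_3)
    (u v K : R -> R)
    (I_open : open I) (I_interval : is_interval I)
    (alpha_frenet : frenet_curve I alpha)
    (gamma_osc : osculating_direction_curve I alpha u v gamma)
    (K_int : forall s, I s -> is_derive s 1 K (curvature alpha s))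
    (uE : forall s, I s -> u s = sin (K s))
    (vE : forall s, I s -> v s = cos (K s)) :
  [/\ frenet_curve I gamma,
      frenet_equations I gamma (binormal alpha)
        (fun s => torsion alpha s * cos (K s))
        (fun s => torsion alpha s * sin (K s)),
      (forall s, I s -> curvature gamma s = `|torsion alpha s * cos (K s)|) &
      (forall s, I s -> torsion gamma s = torsion alpha s * sin (K s))].
Proof.
have fe := frenet_curve_equations I_open alpha_frenet.
set T := tangent alpha in fe *; set N := normal alpha in fe *.
set B := binormal alpha; set tau := torsion alpha in fe *.
set kappa := curvature alpha in fe K_int.
have frame s : I s -> [/\ is_derive s 1 T (kappa s *: N s),
    is_derive s 1 N (- kappa s *: T s + tau s *: B s) &
    is_derive s 1 B (- tau s *: N s)] by move=> /fe[].
(* Two vectors of the frame of [gamma] have this shape: the tangent with coefficients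
   [(sin K, cos K)] and the third vector with [(cos K, - sin K)]. The derivative formula [combD]
   serves both. *)
pose comb (f g : R -> R) y := f y *: T y + g y *: N y.
have combD f g df dg s : I s -> is_derive s 1 f df -> is_derive s 1 g dg ->
    is_derive s 1 (comb f g) ((df - kappa s * g s) *: T s +
      (dg + kappa s * f s) *: N s + (tau s * g s) *: B s).
  move=> Is f' g'; have [T' N' _] := frame s Is.
  have -> : comb f g = (fun y => f y *: T y) + (fun y => g y *: N y) by [].
  apply: is_derive_eq
    (is_deriveD (is_derive_scale f' T') (is_derive_scale g' N')) _.
  move: (T s) (N s) (B s) => t n b.
  by apply/rowP => j; rewrite !mxE; ring.
have sinK' s : I s -> is_derive s 1 (sin \o K) (cos (K s) * kappa s).
  move=> Is; have K' := K_int s Is.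
  by apply: is_derive_eq (is_derive1_comp (is_derive_sin (K s)) K') _.
have cosK' s : I s -> is_derive s 1 (cos \o K) (- sin (K s) * kappa s).
  move=> Is; have K' := K_int s Is.
  by apply: is_derive_eq (is_derive1_comp (is_derive_cos (K s)) K') _.
have XE s : I s -> osculating_field alpha u v s = comb (sin \o K) (cos \o K) s.
  by move=> Is; rewrite /osculating_field uE// vE.
have gE s : I s -> tangent gamma s = comb (sin \o K) (cos \o K) s.
  move=> Is; have [_ [_ _ [_ gX]]] := gamma_osc s Is.
  by rewrite /tangent derive1E gX XE.
have X' s : I s -> is_derive s 1 (comb (sin \o K) (cos \o K))
    ((tau s * cos (K s)) *: B s).
  move=> Is.
  apply: is_derive_eq (combD _ _ _ _ _ Is (sinK' s Is) (cosK' s Is)) _.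
  move: (T s) (N s) (B s) => t n b.
  by apply/rowP => j; rewrite !mxE /=; ring.
(* Since [T x B = - N] and [N x B = T], taking the cross product with [B] is a quarter turn in the
   osculating plane. *)
have gB s : I s -> crossp (tangent gamma s) (B s) =
    comb (cos \o K) (fun y => - sin (K y)) s.
  move=> Is; have [[/enorm1P T1 /enorm1P N1 TN] _] := fe s Is.
  have TB : crossp (T s) (B s) = - N s := frame_tb T1 TN.
  have NB : crossp (N s) (B s) = T s := frame_nb N1 TN.
  rewrite gE// /comb; move: (T s) (N s) (B s) TB NB => t n b TB NB.
  rewrite crosspDl !crosspZl TB NB.
  by rewrite scalerN addrC scaleNr.
have near_I s : I s -> \forall y \near s, I y by exact: near_in_open.
have feg : frenet_equations I gamma B (fun s => tau s * cos (K s))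
    (fun s => tau s * sin (K s)).
  move=> s Is; have [[/enorm1P T1 /enorm1P N1 TN] _] := fe s Is.
  have [_ _ B'] := frame s Is.
  have [_ [X1 _ _]] := gamma_osc s Is.
  split.
    split; first by rewrite gE// -XE.
      exact/enorm1P/frame_bb.
    rewrite gE// /comb /B /binormal -/(T s) -/(N s).
    move: (T s) (N s) => t n.
    by rewrite dotpDl !dotpZl dotp_crossp dotp_crosspr !mulr0 addr0.
  split.
  - apply: near_eq_is_derive (X' s Is).
    by near=> y; rewrite gE//; near: y; exact: near_I.
  - apply: is_derive_eq B' _; rewrite gB// gE// /comb /=.
    (* The [T] components of [- tau cos K (sin K T + cos K N) + tau sin K (cos K T - sin K N)]
       cancel, and the [N] components add up to [- tau (cos^2 K + sin^2 K)]. *)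
    have := cos2Dsin2 (K s).
    move: (T s) (N s) (tau s) => t n r.
    move=> cs; apply/rowP => j; rewrite !mxE.
    rewrite -[n 0 j in LHS]mul1r -cs; ring.
  - have sinKN : is_derive s 1 (fun y => - sin (K y)) (- (cos (K s) * kappa s)).
      exact: is_deriveN (sinK' s Is).
    have := combD _ _ _ _ _ Is (cosK' s Is) sinKN.
    move=> /(near_eq_is_derive _) h; apply: is_derive_eq (h _ _) _.
      by near=> y; rewrite gB//; near: y; exact: near_I.
    move: (T s) (N s) (B s) => t n b.
    by apply/rowP => j; rewrite !mxE /=; ring.
have k0 s : I s -> tau s * cos (K s) != 0.
  move=> Is; have [_ [_ + _]] := gamma_osc s Is.
  apply: contraNneq => k0.
  (* If [tau cos K] vanished at [s], then [X'] would be the zero vector, which lies in every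
     span. *)
  suff -> : (osculating_field alpha u v)^`()%classic s = 0.
    exact: mem0v.
  have [_ X'E] := X' s Is; rewrite derive1E -[RHS](scale0r (B s)) -k0 -X'E.
  by apply: near_eq_derive; near=> y; rewrite XE//; near: y; exact: near_I.
have tau0 s : I s -> tau s != 0.
  by move=> /k0; rewrite mulf_eq0 => /norP[].
have ksg s : I s -> \forall y \near s,
    Num.sg (tau y * cos (K y)) = Num.sg (tau s * cos (K s)).
  move=> Is.
  have cosKc : {for s, continuous (cos \o K)}.
    by apply/differentiable_continuous/derivable1_diffP; case: (cosK' s Is).
  have cosK0 : cos (K s) != 0 by move: (k0 s Is); rewrite mulf_eq0 => /norP[].
  have sgcos : \forall y \near s, Num.sg (cos (K y)) = Num.sg (cos (K s)).
    have [c0|c0|c0] := ltgtP (cos (K s)) 0; last by rewrite c0 eqxx in cosK0.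
    - near=> y; rewrite !ltr0_sg//.
      by near: y; exact: cvgr_lt cosKc _ c0.
    - near=> y; rewrite !gtr0_sg//.
      by near: y; exact: cvgr_gt cosKc _ c0.
  (* The sign of [cos K] was settled by continuity; that of [tau] comes from the Frenet equations of
     [alpha]. *)
  have sgtau := frenet_equations_sg_torsion I_open fe tau0 Is.
  apply: filterS2 sgtau sgcos => y.
  by move: (tau y) (tau s) => a b; rewrite !sgrM => -> ->.
have gd s : I s -> derivable gamma s 1.
  by move=> /gamma_osc[_ [_ _ []]].
by have [fg kg tg] := frenet_equations_curve I_open feg gd k0 ksg.
Unshelve. all: by end_near. Qed.
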